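(* In the linear model with measurement errors and the general subsampling scheme described in the context, suppose that: (A1) the matrix $\mathcal{H}_{W}=\frac{1}{n}\sum_{i=1}^{n}\mathbf{W}_{i}\mathbf{W}_{i}^{T}-\boldsymbol{\Sigma}_{uu}$ converges in probability to a positive definite matrix; (A2) $\frac{1}{n}\sum_{i=1}^{n}\|\mathbf{W}_{i}\|^{4}=O_{P}(1)$ and $\frac{1}{n}\sum_{i=1}^{n}(y_{i}-\mathbf{W}_{i}^{T}\hat{\boldsymbol{\beta}})^{4}=O_{P}(1)$; (A3) $\max_{i=1,\ldots,n}(n\pi_{i})^{-1}=O_{P}(1)$. Then, as $r\to\infty$ and $n\to\infty$, $\tilde{\boldsymbol{\beta}}$ converges to $\hat{\boldsymbol{\beta}}$ in conditional probability given $\mathcal{F}_{n}$, with convergence rate $\sqrt{r}$. That is, with probability approaching one, for any $\varepsilon>0$ there exist finite constants $\Delta_{\varepsilon}$ and $r_{\varepsilon}$ such that $$P\big(\|\tilde{\boldsymbol{\beta}}-\hat{\boldsymbol{\beta}}\|\geq r^{-1/2}\Delta_{\varepsilon}\,\big|\,\mathcal{F}_{n}\big)<\varepsilon$$ for all $r>r_{\varepsilon}$.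
   Context: Model. For $i=1,\ldots,n$, $y_{i}=\mathbf{X}_{i}^{T}\boldsymbol{\beta}+\epsilon_{i}$ and $\mathbf{W}_{i}=\mathbf{X}_{i}+\mathbf{U}_{i}$, where $\mathbf{X}_{i}$ is a $p$-dimensional covariate vector, $y_i$ is the scalar response, $\boldsymbol{\beta}\in\mathbb{R}^{p}$ is unknown, $\epsilon_{i}$ is a random error with mean zero and variance $\sigma^{2}$, and $\mathbf{U}_{i}$ is a random measurement error vector with mean zero and known covariance matrix $\boldsymbol{\Sigma}_{uu}$, independent of $\epsilon_{i}$ and $\mathbf{X}_{i}$. Only $\mathbf{W}_i$ (not $\mathbf{X}_i$) is observed. The full data are $\mathcal{F}_{n}=\{(\mathbf{W}_{i},y_{i}):i=1,\ldots,n\}$. $\|\cdot\|$ is the Euclidean norm. Full-data estimator. $\hat{\boldsymbol{\beta}}=\arg\min_{\boldsymbol{\beta}}\ell(\boldsymbol{\beta})$ with $\ell(\boldsymbol{\beta})=\frac{1}{2n}\sum_{i=1}^{n}(y_{i}-\mathbf{W}_{i}^{T}\boldsymbol{\beta})^{2}-\frac12\boldsymbol{\beta}^{T}\boldsymbol{\Sigma}_{uu}\boldsymbol{\beta}$, i.e. $\hat{\boldsymbol{\beta}}=\big(\sum_{i=1}^{n}\mathbf{W}_{i}\mathbf{W}_{i}^{T}-n\boldsymbol{\Sigma}_{uu}\big)^{-1}\sum_{i=1}^{n}\mathbf{W}_{i}y_{i}$. General subsampling. Given subsampling probabilities $\pi_{1},\ldots,\pi_{n}$ with $\sum_{i=1}^{n}\pi_{i}=1$,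 a random subsample $\{(\mathbf{W}_{i}^{*},y_{i}^{*})\}_{i=1}^{r}$ of size $r$ is drawn from the full data with replacement according to $\{\pi_i\}$; $\pi_{i}^{*}$ denotes the subsampling probability of the $i$-th drawn data point. The subsample estimator is $\tilde{\boldsymbol{\beta}}=\arg\min_{\boldsymbol{\beta}}\ell^{*}(\boldsymbol{\beta})$, where $$\ell^{*}(\boldsymbol{\beta})=\frac{1}{2n}\sum_{i=1}^{r}\frac{1}{r\pi_{i}^{*}}(y_{i}^{*}-\mathbf{W}_{i}^{*T}\boldsymbol{\beta})^{2}-\frac12\boldsymbol{\beta}^{T}\boldsymbol{\Sigma}_{uu}\boldsymbol{\beta}.$$ *)

(* Defs.v *)
From HB Require Import structures.
From mathcomp Require Import all_boot all_order all_algebra.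
From mathcomp Require Import all_classical all_reals all_analysis.

Set Implicit Arguments.
Unset Strict Implicit.
Unset Printing Implicit Defensive.

Import Order.TTheory GRing.Theory Num.Theory.
Import numFieldNormedType.Exports.

Local Open Scope classical_set_scope.
Local Open Scope ring_scope.

Section LinearAlgebra.
Context {R : realType} {p : nat}.

Definition dotv (u v : 'cV[R]_p) : R := (u^T *m v) 0 0.

(* The library norm [`|v|] on matrices is the sup norm, hence this one. *)
Definition enorm (v : 'cV[R]_p) : R := Num.sqrt (\sum_(j < p) v j 0 ^+ 2).

Definition posdefmx (A : 'M[R]_p) : Prop :=
  A^T = A /\ forall v : 'cV[R]_p, v != 0 -> 0 < dotv v (A *m v).

Definition is_argmin (f : 'cV[R]_p -> R) (b : 'cV[R]_p) : Prop :=
  forall c, f b <= f c.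

(* The corrected losses below are quadratics whose Hessian may fail to be
   positive semidefinite, in which case they have no minimizer.  An argmin is a
   minimizer whenever there is one and is otherwise unconstrained. *)
Definition argmin_spec (f : 'cV[R]_p -> R) (b : 'cV[R]_p) : Prop :=
  (exists c, is_argmin f c) -> is_argmin f b.

Definition full_loss (n : nat) (W : nat -> 'cV[R]_p) (y : nat -> R)
    (Sigma : 'M[R]_p) (b : 'cV[R]_p) : R :=
  (2 * n%:R)^-1 * (\sum_(i < n) (y i - dotv (W i) b) ^+ 2)
  - 2^-1 * dotv b (Sigma *m b).

(* [k j] is the index in the full data of the [j]-th drawn point. *)
Definition sub_loss (n r : nat) (W : nat -> 'cV[R]_p) (y : nat -> R)
    (pi : nat -> R) (k : 'I_r -> nat) (Sigma : 'M[R]_p) (b : 'cV[R]_p) : R :=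
  (2 * n%:R)^-1 *
    (\sum_(j < r) (r%:R * pi (k j))^-1 * (y (k j) - dotv (W (k j)) b) ^+ 2)
  - 2^-1 * dotv b (Sigma *m b).

Definition HW (n : nat) (W : nat -> 'cV[R]_p) (Sigma : 'M[R]_p) : 'M[R]_p :=
  n%:R^-1 *: (\sum_(i < n) W i *m (W i)^T) - Sigma.

End LinearAlgebra.

Section Probability.
Context {d : measure_display} {T : measurableType d} {R : realType}.
Variable P : probability T R.

Definition random_vector (p : nat) (V : T -> 'cV[R]_p) : Prop :=
  forall j, measurable_fun [set: T] (fun w => V w j 0).

Definition sigma_fun (f : T -> R) : set (set T) :=
  <<s preimage_set_system [set: T] f measurable >>.

Definition sigma_vec (p : nat) (V : T -> 'cV[R]_p) : set (set T) :=
  <<s \bigcup_(j in [set: 'I_p])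
        preimage_set_system [set: T] (fun w => V w j 0) measurable >>.

Definition sigma_data (p : nat) (W : nat -> T -> 'cV[R]_p) (y : nat -> T -> R)
    (n : nat) : set (set T) :=
  <<s \bigcup_(i in [set i : nat | (i < n)%N])
        (sigma_vec (W i) `|` sigma_fun (y i)) >>.

Definition indep (G1 G2 : set (set T)) : Prop :=
  forall A B, G1 A -> G2 B -> P (A `&` B) = (P A * P B)%E.

(* [g] is a version of the conditional probability [P (A | G)], where [G] is a
   sub-sigma-algebra. *)
Definition is_cond_prob (G : set (set T)) (A : set T) (g : T -> R) : Prop :=
  [/\ forall C : set R, measurable C -> G (g @^-1` C),
      P.-integrable [set: T] (EFin \o g)
    & forall B, G B -> (\int[P]_(w in B) (g w)%:E = P (A `&` B))%E].

Definition mx_cvg_in_prob (p : nat) (Z : nat -> T -> 'M[R]_p) (L : 'M[R]_p)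
    : Prop :=
  forall i j (eta : R), 0 < eta ->
    P [set w | eta <= `|Z n w i j - L i j|] @[n --> \oo] --> 0%E.

(* Extended-real valued, so that [1 / (n pi)] is [+oo] when [pi = 0]. *)
Definition OP1 (Z : nat -> T -> \bar R) : Prop :=
  forall delta : R, 0 < delta -> exists (M : R) (N : nat),
    forall n, (N <= n)%N -> (P [set w | M%:E < `|Z n w|] < delta%:E)%E.

(* The properties [E n] need not be measurable; they contain events whose
   probability tends to one. *)
Definition with_prob_approaching_one (E : nat -> T -> Prop) : Prop :=
  exists A : nat -> set T,
    [/\ forall n, measurable (A n),
        forall n w, A n w -> E n w
      & P (A n) @[n --> \oo] --> 1%E].

End Probability.

(* Main.v *)
Require Import Defs.
From HB Require Import structures.
From mathcomp Require Import all_boot all_order all_algebra.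
From mathcomp Require Import all_classical all_reals all_analysis.
From mathcomp Require Import measurable_realfun ring lra.

Set Implicit Arguments.
Unset Strict Implicit.
Unset Printing Implicit Defensive.

Import Order.TTheory GRing.Theory Num.Theory.
Import numFieldNormedType.Exports.

Local Open Scope classical_set_scope.
Local Open Scope ring_scope.

(** The two estimators are compared through the score of the subsample loss at
    the full-data estimator.  Both corrected losses are quadratics; where the
    Hessian of one is bounded below by [lam > 0], it has a unique minimizer, and
    since its score is affine with slope minus the Hessian, the distance from any
    point [b] to the minimizer is at most [lam^-1] times the norm of the score
    at [b] (lemma [argmin_score_bound]).  At the full-data estimator the
    full-data score vanishes, so the subsample score there is a centered
    inverse-probability-weighted mean of [r] independent draws.  Its variance is
    [O(r^-1)] by the fourth moment bounds and the bound on [(n pi_i)^-1], and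
    the same computation shows that the subsample Hessian is close to the
    full-data one, hence to [H] (lemmas [ipw_mean_variance] and
    [expect_deviation_le]).  The Markov inequality then gives the rate.

    All of this takes place for a fixed dataset, and the estimates are uniform
    over the datasets satisfying [good], which is stated with explicit bounds.
    Convergence in probability and boundedness in probability make this event
    likely (lemma [good_event_likely]).

    It remains to pass to conditional probabilities given the data.  The event
    [good] is decided by the data, because there the full-data estimator is
    given by the closed formula [argmin_formula]; so is, for each fixed sequence
    of drawn indices, the event that the deviation is large.  A sum over the
    finitely many sequences of draws (lemma [measure_randomized_le]) therefore
    turns the bound for a fixed dataset into
    [P (A `&` D) <= e' * P D] for every event [D] of the data inside [good],
    and hence into an almost sure bound on every version of the conditional
    probability (lemmas [cond_prob_lt_ae] and [cond_prob_rate]).  Only countably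
    many thresholds, sample sizes and accuracies occur, so the exceptional null
    sets can be removed all at once; the events that remain serve for both
    halves of the conclusion. *)

(** * Quadratic forms and corrected least squares *)

Section QuadraticForms.
Context {R : realType} {p : nat}.
Implicit Types (u v w : 'cV[R]_p) (A : 'M[R]_p) (c lam : R).

Lemma dotvE u v : dotv u v = \sum_j u j 0 * v j 0.
Proof. by rewrite /dotv mxE; apply: eq_bigr => j _; rewrite mxE. Qed.

Lemma dotv0 u : dotv u 0 = 0.
Proof. by rewrite /dotv mulmx0 mxE. Qed.

Lemma dotvC u v : dotv u v = dotv v u.
Proof. by rewrite !dotvE; apply: eq_bigr => j _; rewrite mulrC. Qed.

Lemma dotvDr u v w : dotv u (v + w) = dotv u v + dotv u w.
Proof. by rewrite /dotv mulmxDr mxE. Qed.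

Lemma dotvDl u v w : dotv (u + v) w = dotv u w + dotv v w.
Proof. by rewrite dotvC dotvDr !(dotvC w). Qed.

Lemma dotvZr c u v : dotv u (c *: v) = c * dotv u v.
Proof. by rewrite /dotv -scalemxAr mxE. Qed.

Lemma dotvZl c u v : dotv (c *: u) v = c * dotv u v.
Proof. by rewrite dotvC dotvZr dotvC. Qed.

Lemma dotvNr u v : dotv u (- v) = - dotv u v.
Proof. by rewrite -scaleN1r dotvZr mulN1r. Qed.

Lemma dotvNl u v : dotv (- u) v = - dotv u v.
Proof. by rewrite dotvC dotvNr dotvC. Qed.

Lemma dotv_sumr (I : finType) u (v : I -> 'cV[R]_p) :
  dotv u (\sum_i v i) = \sum_i dotv u (v i).
Proof. by rewrite /dotv mulmx_sumr summxE. Qed.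

Lemma dotv_ge0 u : 0 <= dotv u u.
Proof. by rewrite dotvE sumr_ge0// => j _; rewrite -expr2 sqr_ge0. Qed.

Lemma dotv_eq0 u : dotv u u <= 0 -> u = 0.
Proof.
move=> u0; have /eqP : dotv u u == 0 by rewrite eq_le u0 dotv_ge0.
rewrite dotvE => /eqP; rewrite psumr_eq0 => [/allP uj|j _]; last first.
  by rewrite -expr2 sqr_ge0.
apply/colP => j; rewrite mxE; apply/eqP.
by have := uj j (mem_index_enum _); rewrite /= mulf_eq0 orbb.
Qed.

Lemma enorm_ge0 u : 0 <= enorm u.
Proof. exact: sqrtr_ge0. Qed.

Lemma enorm_sqr u : enorm u ^+ 2 = dotv u u.
Proof.
rewrite /enorm sqr_sqrtr ?sumr_ge0// => [|j _]; last by rewrite sqr_ge0.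
by rewrite dotvE; apply: eq_bigr => j _; rewrite expr2.
Qed.

Lemma dotv_sym A u v : A^T = A -> dotv u (A *m v) = dotv v (A *m u).
Proof.
move=> AT; rewrite dotvC /dotv trmx_mul AT -mulmxA.
by congr ((_ *m _) _ _).
Qed.

Lemma le_sqr_dotv u j : u j 0 ^+ 2 <= dotv u u.
Proof.
rewrite dotvE (bigD1 j)//= -expr2 lerDl sumr_ge0// => k _.
by rewrite -expr2 sqr_ge0.
Qed.

(** This is [2 |u i| |u j| <= u i ^+ 2 + u j ^+ 2], summed over all pairs of
    indices. *)
Lemma dotv_mulmx_le A (eta : R) u :
  (forall i j, `|A i j| <= eta) -> `|dotv u (A *m u)| <= eta * p%:R * dotv u u.
Proof.
move=> Ale; have -> : dotv u (A *m u) = \sum_i \sum_j u i 0 * (A i j * u j 0).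
  rewrite dotvE; apply: eq_bigr => i _; rewrite mxE mulr_sumr.
  by apply: eq_bigr.
apply: le_trans (ler_norm_sum _ _ _) _.
have aux i j : `|u i 0 * (A i j * u j 0)| <=
    eta * 2^-1 * u i 0 ^+ 2 + eta * 2^-1 * u j 0 ^+ 2.
  rewrite !normrM; have := Ale i j; have := normr_ge0 (A i j).
  rewrite -(real_normK (num_real (u i 0))) -(real_normK (num_real (u j 0))).
  set a := `|A i j|; set x := `|u i 0|; set z := `|u j 0| => a0 ae.
  have x0 : 0 <= x by rewrite normr_ge0.
  have z0 : 0 <= z by rewrite normr_ge0.
  have : 0 <= eta * (x - z) ^+ 2 by rewrite mulr_ge0 ?sqr_ge0// (le_trans a0).
  have : a * (x * z) <= eta * (x * z) by rewrite ler_wpM2r// mulr_ge0.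
  lra.
apply: (@le_trans _ _ (\sum_(i < p) (eta * 2^-1 * u i 0 ^+ 2 *+ p
    + eta * 2^-1 * dotv u u))).
  apply: ler_sum => i _; apply: le_trans (ler_norm_sum _ _ _) _.
  rewrite dotvE mulr_sumr -[p in _ *+ p]card_ord -sumr_const -big_split/=.
  by apply: ler_sum => j _; rewrite -expr2.
rewrite big_split/= sumr_const card_ord.
under eq_bigr do rewrite -mulrnAl.
rewrite -mulr_sumr.
under eq_bigr do rewrite expr2.
rewrite -(dotvE u u) -[eta * 2^-1 *+ p]mulr_natr.
rewrite -[_ * _ *+ p]mulr_natr.
move: (dotv u u) (p%:R) => D k.
have -> : eta * 2^-1 * k * D + eta * 2^-1 * D * k = eta * k * D by field.
by [].
Qed.

Definition coercive lam A := forall u, lam * dotv u u <= dotv u (A *m u).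

Lemma unitmx_ker0 A : (forall u, A *m u = 0 -> u = 0) -> A \in unitmx.
Proof.
move=> A0; rewrite -unitmx_tr -row_free_unit -kermx_eq0.
apply/eqP/row_matrixP => i; rewrite row0.
have := mulmx_ker A^T => /(congr1 (row i)); rewrite row_mul row0.
set u := row i _ => uA; apply: trmx_inj; rewrite trmx0; apply: A0.
by rewrite -[A]trmxK -trmx_mul uA trmx0.
Qed.

Lemma coercive_unitmx lam A : 0 < lam -> coercive lam A -> A \in unitmx.
Proof.
move=> lam0 cA; apply: unitmx_ker0 => u Au; apply: dotv_eq0.
by have := cA u; rewrite Au dotv0 pmulr_rle0.
Qed.

(** Expanding [0 <= (u - t A^-1 u)^T A (u - t A^-1 u)] bounds [u^T A u] below by
    [2 t |u|^2 - t^2 u^T A^-1 u].  If [u^T A^-1 u <= C |u|^2], which holds for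
    some [C] in terms of the entries of [A^-1], then [t = C^-1] gives the lower
    bound [C^-1 |u|^2]. *)
Lemma posdef_coercive A : posdefmx A -> exists2 lam, 0 < lam & coercive lam A.
Proof.
move=> [AT Apos].
have A0 u : 0 <= dotv u (A *m u).
  have [->|/Apos/ltW//] := eqVneq u 0.
  by rewrite mulmx0 dotv0.
have Au : A \in unitmx.
  apply: unitmx_ker0 => u Au0; apply/eqP; apply: contraT => /Apos.
  by rewrite Au0 dotv0 ltxx.
pose m := \sum_i \sum_j `|invmx A i j|.
have m0 : 0 <= m by rewrite sumr_ge0// => i _; rewrite sumr_ge0.
have mle i j : `|invmx A i j| <= m.
  rewrite /m (bigD1 i)//= (bigD1 j)//= -addrA lerDl addr_ge0 ?sumr_ge0// => k _.
  by rewrite sumr_ge0.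
pose C := m * p%:R + 1.
have C0 : 0 < C by rewrite ltr_wpDl// mulr_ge0.
exists C^-1; first by rewrite invr_gt0.
move=> u; have := A0 (u - C^-1 *: (invmx A *m u)).
have := dotv_mulmx_le u mle => /ler_normlP[_].
rewrite mulmxBr -scalemxAr mulmxA mulmxV// mul1mx.
rewrite dotvDl !dotvDr !dotvNr !dotvNl !dotvZl !dotvZr.
rewrite (dotv_sym (invmx A *m u) u AT) mulmxA mulmxV// mul1mx.
rewrite (dotvC (invmx A *m u)).
set s := dotv u u; set q := dotv u (A *m u); set k := dotv _ _ => kle.
have s0 : 0 <= s by apply: dotv_ge0.
have kC : C^-1 * (C^-1 * k) <= C^-1 * s.
  rewrite ler_pM2l ?invr_gt0// mulrC ler_pdivrMr// (le_trans kle)// mulrC.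
  by rewrite ler_wpM2l// /C lerDl.
lra.
Qed.

Lemma coercive_perturb lam (eta : R) A (B : 'M[R]_p) : coercive lam A ->
  (forall i j, `|B i j - A i j| <= eta) -> coercive (lam - eta * p%:R) B.
Proof.
move=> cA BA u; have := cA u.
have /(dotv_mulmx_le u)/ler_normlP[+ _] : forall i j, `|(B - A) i j| <= eta.
  by move=> i j; rewrite !mxE.
rewrite mulmxBl dotvDr dotvNr; lra.
Qed.

End QuadraticForms.

Section CorrectedLeastSquares.
Context {R : realType} {p : nat} {I : finType}.
Variables (om : I -> R) (x : I -> 'cV[R]_p) (y : I -> R) (S : 'M[R]_p).
Hypothesis S_sym : S^T = S.
Implicit Types (b c u : 'cV[R]_p).

Definition wloss b : R :=
  2^-1 * (\sum_i om i * (y i - dotv (x i) b) ^+ 2) - 2^-1 * dotv b (S *m b).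

Definition whess : 'M[R]_p := \sum_i om i *: (x i *m (x i)^T) - S.

Definition wscore b : 'cV[R]_p :=
  \sum_i (om i * (y i - dotv (x i) b)) *: x i + S *m b.

Lemma wscoreD b u : wscore (b + u) = wscore b - whess *m u.
Proof.
rewrite /wscore /whess mulmxBl mulmx_suml opprB mulmxDr [S *m u - _]addrC.
rewrite [RHS]addrACA -sumrB; congr (_ + _); apply: eq_bigr => i _.
rewrite dotvDr opprD addrA mulrBr scalerBl; congr (_ - _).
rewrite -scalemxAl -mulmxA -scalerA; congr (_ *: _).
by rewrite [_^T *m u]mx11_scalar mul_mx_scalar.
Qed.

Lemma wlossD b u : wloss (b + u) =
  wloss b - dotv u (wscore b) + 2^-1 * dotv u (whess *m u).
Proof.
rewrite /wloss /wscore /whess mulmxBl mulmx_suml.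
rewrite mulmxDr dotvDl !dotvDr (dotv_sym b u S_sym) dotvNr !dotv_sumr.
set s1 := \sum_i _; set s2 := \sum_i _; set s3 := \sum_i _; set s4 := \sum_i _.
suff -> : s1 = s2 - 2 * s3 + s4 by lra.
rewrite mulr_sumr -sumrB -big_split/=; apply: eq_bigr => i _.
rewrite -scalemxAl -mulmxA !dotvZr.
have -> : dotv u (x i *m ((x i)^T *m u)) = dotv (x i) u ^+ 2.
  rewrite [_^T *m u]mx11_scalar mul_mx_scalar dotvZr -/(dotv _ _).
  by rewrite dotvC expr2.
by rewrite dotvDr (dotvC u (x i)); ring.
Qed.

(** The loss is a quadratic whose Hessian [whess] is positive definite here, so
    it has exactly one minimizer and the score vanishes there.  The score is
    affine with slope [- whess], hence its value at [b] measures how far [b] is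
    from that minimizer. *)
Lemma argmin_score_bound lam b c : 0 < lam -> coercive lam whess ->
  argmin_spec wloss c ->
  lam ^+ 2 * dotv (c - b) (c - b) <= dotv (wscore b) (wscore b).
Proof.
move=> lam0 cH cmin.
pose m := b + invmx whess *m wscore b.
have sm : wscore m = 0.
  by rewrite wscoreD mulmxA mulmxV ?(coercive_unitmx lam0 cH)// mul1mx subrr.
have lossm u : wloss (m + u) = wloss m + 2^-1 * dotv u (whess *m u).
  by rewrite wlossD sm dotv0 subr0.
have /(_ m) : is_argmin wloss c.
  apply: cmin; exists m => u; rewrite -[u](subrKC m) lossm lerDl.
  by rewrite mulr_ge0// (le_trans _ (cH _))// mulr_ge0 ?dotv_ge0 ?ltW.
rewrite -[c in wloss c](subrKC m) lossm gerDl pmulr_rle0// => cm.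
have {cm} /eqP : c - m = 0.
  apply: dotv_eq0; rewrite -(pmulr_rle0 _ lam0).
  exact: le_trans (cH _) cm.
rewrite subr_eq0 => /eqP ->; rewrite /m addrC addKr.
set u := invmx _ *m _.
have -> : wscore b = whess *m u.
  by rewrite mulmxA mulmxV ?(coercive_unitmx lam0 cH)// mul1mx.
have := dotv_ge0 (whess *m u - lam *: u).
rewrite dotvDl !dotvDr !dotvNr !dotvNl !dotvZl !dotvZr (dotvC _ u).
have := ler_wpM2l (ltW lam0) (cH u); lra.
Qed.

End CorrectedLeastSquares.

(** * Sampling with replacement *)

Section SamplingWithReplacement.
Context {R : realType} {I J : finType}.
Variable q : I -> R.
Hypothesis q1 : \sum_i q i = 1.
Implicit Types (k : {ffun J -> I}) (h : I -> R).

Definition draw_prob k : R := \prod_j q (k j).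

(** The product of two factors depending on draws [j] and [l] is a product over
    all draws, so its expectation factors over the draws. *)
Lemma expect_draw2 h j l :
  \sum_k draw_prob k * (h (k j) * h (k l)) =
  if j == l then \sum_i q i * h i ^+ 2 else (\sum_i q i * h i) ^+ 2.
Proof.
pose F m i := q i * ((if m == j then h i else 1) * (if m == l then h i else 1)).
transitivity (\sum_(k : {ffun J -> I}) \prod_m F m (k m)).
  apply: eq_bigr => k _; rewrite /F !big_split/= -!big_mkcond/=.
  by rewrite !big_pred1_eq.
rewrite -(bigA_distr_bigA F) /F; case: eqVneq => [<-|jl].
  rewrite (bigD1 j)//= [\prod_(m | _) _]big1 ?mulr1 => [|m /negPf mj].
    by apply: eq_bigr => i _; rewrite eqxx expr2.
  by rewrite mj -[RHS]q1; apply: eq_bigr => i _; rewrite !mulr1.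
rewrite (bigD1 j)//= (bigD1 l)//= 1?eq_sym//.
rewrite [\prod_(m | _) _]big1 ?mulr1; last first.
  move=> m /andP[/negPf mj /negPf ml]; rewrite mj ml -[RHS]q1.
  by apply: eq_bigr => i _; rewrite !mulr1.
rewrite !eqxx [l == j]eq_sym (negPf jl) expr2; congr (_ * _).
  by apply: eq_bigr => i _; rewrite mulr1.
by apply: eq_bigr => i _; rewrite mul1r.
Qed.

(** Distinct draws are uncorrelated, so that only the diagonal survives when
    the square of a centered sum is expanded. *)
Lemma centered_second_moment h : \sum_i q i * h i = 0 ->
  \sum_k draw_prob k * (\sum_j h (k j)) ^+ 2 = #|J|%:R * \sum_i q i * h i ^+ 2.
Proof.
move=> h0; transitivity (\sum_k \sum_j \sum_l
    draw_prob k * (h (k j) * h (k l))).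
  apply: eq_bigr => k _; rewrite expr2 mulr_suml mulr_sumr.
  by apply: eq_bigr => j _; rewrite !mulr_sumr.
rewrite exchange_big/= -sum1_card natr_sum mulr_suml.
apply: eq_bigr => j _; rewrite exchange_big/= mul1r.
rewrite (bigD1 j)//= expect_draw2 eqxx [X in _ + X]big1 ?addr0// => l /negPf lj.
by rewrite expect_draw2 eq_sym lj h0 expr0n.
Qed.

End SamplingWithReplacement.

(** This bounds the variance of the inverse-probability-weighted
    (Hansen-Hurwitz) estimator of a population mean.  One draw has second moment
    [n^-2 \sum_i f i ^+ 2 / q i], where [M] bounds each [(n q i)^-1]. *)
Lemma ipw_mean_variance (R : realType) (n r : nat) (q f : 'I_n -> R) (M : R) :
  (0 < n)%N -> (0 < r)%N -> \sum_i q i = 1 -> (forall i, 0 <= q i) ->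
  (forall i, 1 <= M * (n%:R * q i)) ->
  \sum_(k : {ffun 'I_r -> 'I_n}) draw_prob q k *
    (\sum_j (n%:R * (r%:R * q (k j)))^-1 * f (k j) - n%:R^-1 * \sum_i f i) ^+ 2
  <= M / r%:R * (n%:R^-1 * \sum_i f i ^+ 2).
Proof.
move=> n0 r0 q1 q0 Mq.
have nR : 0 < n%:R :> R by rewrite ltr0n.
have rR : 0 < r%:R :> R by rewrite ltr0n.
have qp i : 0 < q i.
  rewrite lt_neqAle q0 andbT eq_sym; apply/eqP => qi.
  by have := Mq i; rewrite qi !mulr0 ler10.
pose m := n%:R^-1 * \sum_i f i.
pose a i := (n%:R * q i)^-1 * f i.
have qa : \sum_i q i * a i = m.
  rewrite /m mulr_sumr; apply: eq_bigr => i _; rewrite /a.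
  by field; rewrite !gt_eqF ?qp.
have h0 : \sum_i q i * (a i - m) = 0.
  under eq_bigr do rewrite mulrBr.
  by rewrite sumrB qa -mulr_suml q1 mul1r subrr.
have -> : \sum_(k : {ffun 'I_r -> 'I_n}) draw_prob q k *
    (\sum_j (n%:R * (r%:R * q (k j)))^-1 * f (k j) - n%:R^-1 * \sum_i f i) ^+ 2
  = \sum_(k : {ffun 'I_r -> 'I_n})
    r%:R ^- 2 * (draw_prob q k * (\sum_j (a (k j) - m)) ^+ 2).
  apply: eq_bigr => k _; rewrite [RHS]mulrCA; congr (_ * _).
  rewrite sumrB sumr_const card_ord -exprVn -exprMn mulrBr -/m.
  congr ((_ - _) ^+ 2).
    rewrite mulr_sumr; apply: eq_bigr => j _; rewrite /a.
    by field; rewrite !gt_eqF ?qp.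
  by rewrite -[m *+ r]mulr_natl mulrA mulVf ?mul1r// gt_eqF.
rewrite -mulr_sumr (centered_second_moment q1 h0) card_ord.
have -> : \sum_i q i * (a i - m) ^+ 2 = \sum_i q i * a i ^+ 2 - m ^+ 2.
  transitivity (\sum_i (q i * a i ^+ 2 - 2 * m * (q i * (a i - m))
      - m ^+ 2 * q i)).
    by apply: eq_bigr => i _; ring.
  by rewrite !sumrB -!mulr_sumr h0 q1; ring.
have -> : r%:R ^- 2 * (r%:R * (\sum_i q i * a i ^+ 2 - m ^+ 2)) =
    r%:R^-1 * (\sum_i q i * a i ^+ 2 - m ^+ 2) by field; rewrite gt_eqF.
rewrite [M / _]mulrC -mulrA ler_pM2l ?invr_gt0//.
rewrite lerBlDr ler_wpDr ?sqr_ge0// mulrA mulr_sumr; apply: ler_sum => i _.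
rewrite /a; have -> : q i * ((n%:R * q i)^-1 * f i) ^+ 2 =
    (n%:R * q i)^-1 * (n%:R^-1 * f i ^+ 2).
  by field; rewrite !gt_eqF ?qp.
rewrite -mulrA ler_wpM2r//.
  by rewrite mulr_ge0 ?sqr_ge0// invr_ge0 ltW.
by rewrite -[leLHS]mul1r ler_pdivrMr ?mulr_gt0.
Qed.

(** * Deviation of the subsample loss for a fixed dataset *)

Section OneDataset.
Context {R : realType} {p : nat}.
Variables (n : nat) (W : nat -> 'cV[R]_p) (y : nat -> R) (S : 'M[R]_p).
Variable q : nat -> R.
Hypothesis S_sym : S^T = S.
Hypothesis n_gt0 : (0 < n)%N.

Definition full_score b :=
  wscore (fun _ : 'I_n => n%:R^-1) (fun i => W i) (fun i => y i) S b.

Lemma full_lossE : full_loss n W y S =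
  wloss (fun _ : 'I_n => n%:R^-1) (fun i => W i) (fun i => y i) S.
Proof.
apply/funext => b; rewrite /full_loss /wloss invfM -mulrA; congr (_ * _ - _).
by rewrite mulr_sumr.
Qed.

Lemma HW_whess :
  HW n W S = whess (fun _ : 'I_n => n%:R^-1) (fun i => W i) S.
Proof. by rewrite /HW /whess scaler_sumr. Qed.

(** This is the minimizer when the Hessian is positive definite.  It is a function
    of the data in every case, unlike a point satisfying [argmin_spec], which is
    unconstrained when the loss has no minimizer. *)
Definition argmin_formula : 'cV[R]_p :=
  invmx (HW n W S) *m (n%:R^-1 *: \sum_(i < n) y i *: W i).

Lemma full_score_argmin_formula :
  HW n W S \in unitmx -> full_score argmin_formula = 0.
Proof.
move=> Hu; rewrite /full_score -[argmin_formula]add0r wscoreD -HW_whess.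
rewrite /argmin_formula mulmxA mulmxV// mul1mx /wscore mulmx0 addr0.
apply/eqP; rewrite subr_eq0 scaler_sumr; apply/eqP; apply: eq_bigr => i _.
by rewrite dotv0 subr0 scalerA.
Qed.

Lemma argmin_full_loss (lam : R) b : 0 < lam -> coercive lam (HW n W S) ->
  argmin_spec (full_loss n W y S) b -> b = argmin_formula.
Proof.
move=> lam0 cH; rewrite full_lossE => bmin.
have := cH; rewrite HW_whess => cH'.
have := argmin_score_bound S_sym argmin_formula lam0 cH' bmin.
rewrite -/(full_score _) full_score_argmin_formula; last first.
  exact: coercive_unitmx lam0 cH.
rewrite dotv0 pmulr_rle0 ?exprn_gt0// => /dotv_eq0/eqP.
by rewrite subr_eq0 => /eqP.
Qed.

Section Subsample.
Variable r : nat.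
Implicit Type k : 'I_r -> nat.
Hypothesis r_gt0 : (0 < r)%N.

Definition ipw k (j : 'I_r) : R := (n%:R * (r%:R * q (k j)))^-1.

Definition sub_hess k := whess (ipw k) (fun j => W (k j)) S.

Definition sub_score k b :=
  wscore (ipw k) (fun j => W (k j)) (fun j => y (k j)) S b.

Lemma sub_lossE k : sub_loss n W y q k S =
  wloss (ipw k) (fun j => W (k j)) (fun j => y (k j)) S.
Proof.
apply/funext => b; rewrite /sub_loss /wloss invfM -mulrA; congr (_ * _ - _).
by rewrite mulr_sumr; apply: eq_bigr => j _; rewrite mulrA /ipw !invfM.
Qed.

(** A single nonnegative quantity whose smallness makes both the Hessian and
    the score of the subsample loss close to those of the full loss, so that
    one application of the Markov inequality controls the two of them. *)
Definition deviation (eta c : R) (b : 'cV[R]_p) k : R :=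
  (\sum_i \sum_j (sub_hess k i j - HW n W S i j) ^+ 2) / eta ^+ 2
  + r%:R * dotv (sub_score k b) (sub_score k b) / c ^+ 2.

Lemma deviation_ge0 (eta c : R) b k : 0 <= deviation eta c b k.
Proof.
rewrite addr_ge0// divr_ge0 ?sqr_ge0//; last by rewrite mulr_ge0 ?dotv_ge0.
by rewrite sumr_ge0// => i _; rewrite sumr_ge0// => j _; rewrite sqr_ge0.
Qed.

(** A deviation below [1] bounds the change of the Hessian entrywise by [eta],
    which leaves it bounded below by [lam], and bounds the norm of the score by
    [lam * Delta] divided by the root of [r]. *)
Lemma argmin_sub_loss_near (lam eta Delta : R) b c k :
  0 < lam -> 0 < eta -> 0 < Delta ->
  coercive (lam + eta * p%:R) (HW n W S) ->
  argmin_spec (sub_loss n W y q k S) c ->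
  deviation eta (lam * Delta) b k < 1 ->
  enorm (c - b) < (Num.sqrt r%:R)^-1 * Delta.
Proof.
move=> lam0 eta0 Delta0 cH; rewrite sub_lossE => cmin.
rewrite /deviation; set dH := \sum_i _; set ds := dotv _ _ => dev1.
have dH0 : 0 <= dH.
  by rewrite sumr_ge0// => i _; rewrite sumr_ge0// => j _; rewrite sqr_ge0.
have ds0 : 0 <= ds by rewrite dotv_ge0.
have rR : 0 < r%:R :> R by rewrite ltr0n.
have /andP[dHlt dslt] : (dH / eta ^+ 2 < 1) &&
    (r%:R * ds / (lam * Delta) ^+ 2 < 1).
  have : 0 <= dH / eta ^+ 2 by rewrite divr_ge0 ?sqr_ge0.
  have : 0 <= r%:R * ds / (lam * Delta) ^+ 2.
    by rewrite divr_ge0 ?sqr_ge0// mulr_ge0.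
  by move: dev1; set u := dH / _; set v := _ / _ => *; apply/andP; split; lra.
have cS : coercive lam (sub_hess k).
  rewrite -[lam](addrK (eta * p%:R)); apply: coercive_perturb cH _ => i j.
  rewrite -ler_sqr ?nnegrE ?(ltW eta0)// real_normK ?num_real//.
  move: dHlt; rewrite ltr_pdivrMr ?exprn_gt0// mul1r => /ltW; apply: le_trans.
  rewrite /dH (bigD1 i)//= (bigD1 j)//= -addrA lerDl addr_ge0//.
    by rewrite sumr_ge0// => *; rewrite sqr_ge0.
  by rewrite sumr_ge0// => *; rewrite sumr_ge0// => *; rewrite sqr_ge0.
have := argmin_score_bound S_sym b lam0 cS cmin; rewrite -/(sub_score k b) -/ds.
rewrite -enorm_sqr => cb.
have sr0 : 0 < Num.sqrt r%:R :> R by rewrite sqrtr_gt0.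
rewrite mulrC ltr_pdivlMr// -ltr_sqr ?nnegrE ?mulr_ge0 ?enorm_ge0 ?sqrtr_ge0//;
  last exact: ltW.
have lam2 : 0 < lam ^+ 2 by rewrite exprn_gt0.
move: dslt; rewrite ltr_pdivrMr ?exprn_gt0 ?mulr_gt0// mul1r => dslt.
suff : lam ^+ 2 * (enorm (c - b) * Num.sqrt r%:R) ^+ 2 < lam ^+ 2 * Delta ^+ 2.
  by rewrite ltr_pM2l.
rewrite -[ltRHS]exprMn; apply: le_lt_trans dslt.
have -> : (enorm (c - b) * Num.sqrt r%:R) ^+ 2 = enorm (c - b) ^+ 2 * r%:R.
  by rewrite exprMn (@sqr_sqrtr _ r%:R) ?(ltW rR).
rewrite mulrA mulrC.
by rewrite ler_pM2l.
Qed.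

(** Entries of [sub_hess k - HW n W S] and of the subsample score are centered
    inverse-probability-weighted means, the latter because the full-data score
    vanishes at [b].  The fourth moments enter because a squared entry of
    [W i *m (W i)^T] or of [(y i - dotv (W i) b) *: W i] is at most a combination
    of fourth powers. *)
Lemma expect_deviation_le (M eta c : R) b :
  \sum_(i < n) q i = 1 -> (forall i, (i < n)%N -> 0 <= q i) ->
  (forall i, (i < n)%N -> 1 <= M * (n%:R * q i)) -> 0 <= M ->
  n%:R^-1 * \sum_(i < n) enorm (W i) ^+ 4 <= M ->
  n%:R^-1 * \sum_(i < n) (y i - dotv (W i) b) ^+ 4 <= M ->
  full_score b = 0 ->
  \sum_(k : {ffun 'I_r -> 'I_n}) draw_prob (fun i : 'I_n => q i) k *
     deviation eta c b (fun j => k j)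
  <= p%:R ^+ 2 * M ^+ 2 / (r%:R * eta ^+ 2) + p%:R * M ^+ 2 / c ^+ 2.
Proof.
move=> q1 q0 qM M0 W4 y4 sb.
have rR : 0 < r%:R :> R by rewrite ltr0n.
have nR : 0 < n%:R :> R by rewrite ltr0n.
have var (f : 'I_n -> R) : n%:R^-1 * \sum_i f i ^+ 2 <= M ->
  \sum_(k : {ffun 'I_r -> 'I_n}) draw_prob (fun i : 'I_n => q i) k *
    (\sum_j ipw (fun j => k j) j * f (k j) - n%:R^-1 * \sum_i f i) ^+ 2
  <= M ^+ 2 / r%:R.
  move=> fM; apply: le_trans (ipw_mean_variance _ n_gt0 r_gt0 q1 _ _) _.
  - by move=> i; apply: q0.
  - by move=> i; apply: qM.
  - by rewrite mulrAC expr2 ler_pM2r ?invr_gt0// ler_wpM2l.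
have varH i j : \sum_(k : {ffun 'I_r -> 'I_n})
    draw_prob (fun i : 'I_n => q i) k *
    (sub_hess (fun j => k j) i j - HW n W S i j) ^+ 2 <= M ^+ 2 / r%:R.
  apply: le_trans (var (fun l => W l i 0 * W l j 0) _); last first.
    apply: le_trans W4; rewrite ler_pM2l ?invr_gt0//; apply: ler_sum => l _.
    rewrite (exprM _ 2 2) enorm_sqr exprMn [leRHS]expr2.
    by rewrite ler_pM ?sqr_ge0// le_sqr_dotv.
  apply: ler_sum => k _; rewrite le_eqVlt; apply/orP; left; apply/eqP.
  congr (_ * _ ^+ 2); rewrite HW_whess /sub_hess /whess !mxE !summxE.
  (* The correction by [S] is the same in both Hessians and cancels. *)
  rewrite opprB addrA subrK mulr_sumr.
  by congr (_ - _); apply: eq_bigr => l _; rewrite !mxE big_ord1 !mxE.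
have vars i : \sum_(k : {ffun 'I_r -> 'I_n}) draw_prob (fun i : 'I_n => q i) k *
    sub_score (fun j => k j) b i 0 ^+ 2 <= M ^+ 2 / r%:R.
  apply: le_trans (var (fun l => (y l - dotv (W l) b) * W l i 0) _); last first.
    apply: (@le_trans _ _ (2^-1 * (n%:R^-1 * \sum_(i < n) enorm (W i) ^+ 4)
      + 2^-1 * (n%:R^-1 * \sum_(i < n) (y i - dotv (W i) b) ^+ 4))); last lra.
    rewrite -mulrDr -mulrDr -big_split/= mulrCA ler_pM2l ?invr_gt0// mulr_sumr.
    apply: ler_sum => l _.
    rewrite !(exprM _ 2 2) enorm_sqr exprMn.
    have := le_sqr_dotv (W l) i; have := sqr_ge0 (W l i 0).
    have := sqr_ge0 (y l - dotv (W l) b).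
    set x := _ ^+ 2; set z := _ ^+ 2; set t := dotv _ _ => x0 z0 zt.
    have : x * z <= x * t by rewrite ler_wpM2l.
    have := sqr_ge0 (x - t); rewrite sqrrB; lra.
  apply: ler_sum => k _; rewrite le_eqVlt; apply/orP; left; apply/eqP.
  congr (_ * _ ^+ 2); have /(congr1 (fun v : 'cV_p => v i 0)) := sb.
  rewrite /full_score /sub_score /wscore !mxE !summxE => /eqP.
  rewrite addrC addr_eq0 => /eqP ->; rewrite mulr_sumr.
  by congr (_ - _); apply: eq_bigr => l _; rewrite !mxE !mulrA.
under eq_bigr do rewrite mulrDr.
rewrite big_split/= lerD//.
  under eq_bigr do rewrite mulrA.
  rewrite -mulr_suml.
  rewrite [leRHS](_ : _ = (p%:R * (p%:R * (M ^+ 2 / r%:R))) / eta ^+ 2);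
    last by rewrite invfM; ring.
  rewrite ler_wpM2r ?invr_ge0 ?sqr_ge0//.
  under eq_bigr => k _.
    rewrite mulr_sumr; under eq_bigr do rewrite mulr_sumr; over.
  rewrite exchange_big/=.
  rewrite [leRHS](_ : _ = \sum_(i < p) (p%:R * (M ^+ 2 / r%:R))); last first.
    by rewrite sumr_const card_ord [LHS]mulr_natl.
  apply: ler_sum => i _; rewrite exchange_big/=.
  rewrite [leRHS](_ : _ = \sum_(j < p) (M ^+ 2 / r%:R)); last first.
    by rewrite sumr_const card_ord [LHS]mulr_natl.
  exact: ler_sum.
under eq_bigr do rewrite mulrA.
rewrite -mulr_suml ler_wpM2r ?invr_ge0 ?sqr_ge0//.
under eq_bigr do rewrite mulrCA.
rewrite -mulr_sumr mulrC -ler_pdivlMr// -mulrA.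
under eq_bigr do rewrite dotvE mulr_sumr.
rewrite exchange_big/=.
rewrite [leRHS](_ : _ = \sum_(i < p) (M ^+ 2 / r%:R)); last first.
  by rewrite sumr_const card_ord [LHS]mulr_natl.
apply: ler_sum => i _; apply: le_trans (vars i).
by apply: ler_sum => k _; rewrite expr2.
Qed.

(** The Markov inequality at level [1]. *)
Lemma prob_deviation_le (M eta c : R) b :
  \sum_(i < n) q i = 1 -> (forall i, (i < n)%N -> 0 <= q i) ->
  (forall i, (i < n)%N -> 1 <= M * (n%:R * q i)) -> 0 <= M ->
  n%:R^-1 * \sum_(i < n) enorm (W i) ^+ 4 <= M ->
  n%:R^-1 * \sum_(i < n) (y i - dotv (W i) b) ^+ 4 <= M ->
  full_score b = 0 ->
  \sum_(k : {ffun 'I_r -> 'I_n} | 1 <= deviation eta c b (fun j => k j))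
     draw_prob (fun i : 'I_n => q i) k
  <= p%:R ^+ 2 * M ^+ 2 / (r%:R * eta ^+ 2) + p%:R * M ^+ 2 / c ^+ 2.
Proof.
move=> q1 q0 qM M0 W4 y4 sb.
apply: le_trans (expect_deviation_le eta c q1 q0 qM M0 W4 y4 sb).
rewrite big_mkcond/=; apply: ler_sum => k _.
have pk0 : 0 <= draw_prob (fun i : 'I_n => q i) k.
  by rewrite prodr_ge0// => j _; apply: q0.
case: ifPn => [dev1|_]; last by rewrite mulr_ge0// deviation_ge0.
by rewrite -[leLHS]mulr1 ler_wpM2l.
Qed.

End Subsample.
End OneDataset.

(** * Measurability and conditional probabilities *)

Section MeasurableMatrices.
Context {d : measure_display} {T : measurableType d} {R : realType}.

Lemma measurable_inv (f : T -> R) :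
  measurable_fun [set: T] f -> measurable_fun [set: T] (fun w => (f w)^-1).
Proof.
move=> mf; apply: (measurableT_comp _ mf).
(* The inverse is continuous off [0], which is a measurable singleton. *)
have -> : [set: R] = [set 0] `|` ~` [set 0] by rewrite setUv.
apply/measurable_funU => //; first exact: measurableC.
split; first exact: measurable_fun_set1.
apply: open_continuous_measurable_fun => [|x].
  exact/closed_openC/closed_eq.
by rewrite inE/= => /eqP x0; apply: inv_continuous.
Qed.

Lemma measurable_set_le (f g : T -> R) : measurable_fun [set: T] f ->
  measurable_fun [set: T] g -> measurable [set w | f w <= g w].
Proof.
by move=> mf mg; rewrite -[X in measurable X]setTI; apply: measurable_fun_le.
Qed.

Lemma measurable_set_lt (f g : T -> R) : measurable_fun [set: T] f ->
  measurable_fun [set: T] g -> measurable [set w | f w < g w].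
Proof.
move=> mf mg; rewrite (_ : mkset _ = ~` [set w | g w <= f w]).
  by apply/measurableC/measurable_set_le.
by apply/seteqP; split => w /=; rewrite ltNge => /negP.
Qed.

Lemma measurable_forall (I : finType) (A : I -> set T) :
  (forall i, measurable (A i)) -> measurable [set w | forall i, A i w].
Proof.
move=> mA; rewrite (_ : mkset _ = \bigcap_(i in [set: I]) A i).
  by apply: fin_bigcap_measurable => // i _.
by apply/seteqP; split => w /= wA i => [_|]; apply: wA.
Qed.

Definition mx_measurable m n (V : T -> 'M[R]_(m, n)) :=
  forall i j, measurable_fun [set: T] (fun w => V w i j).

Lemma mx_measurable_cst m n (A : 'M[R]_(m, n)) : mx_measurable (fun=> A).
Proof. by move=> i j; apply: measurable_cst. Qed.

Lemma mx_measurableD m n (A B : T -> 'M[R]_(m, n)) :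
  mx_measurable A -> mx_measurable B -> mx_measurable (fun w => A w + B w).
Proof.
move=> mA mB i j; under eq_fun do rewrite mxE.
exact: measurable_funD.
Qed.

Lemma mx_measurableN m n (A : T -> 'M[R]_(m, n)) :
  mx_measurable A -> mx_measurable (fun w => - A w).
Proof.
move=> mA i j; under eq_fun do rewrite mxE.
exact: measurable_funN.
Qed.

Lemma mx_measurableZ m n (f : T -> R) (A : T -> 'M[R]_(m, n)) :
  measurable_fun [set: T] f -> mx_measurable A ->
  mx_measurable (fun w => f w *: A w).
Proof.
move=> mf mA i j; under eq_fun do rewrite mxE.
exact: measurable_funM.
Qed.

Lemma mx_measurable_tr m n (A : T -> 'M[R]_(m, n)) :
  mx_measurable A -> mx_measurable (fun w => (A w)^T).
Proof. by move=> mA i j; under eq_fun do rewrite mxE; apply: mA. Qed.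

Lemma mx_measurableM m n l (A : T -> 'M[R]_(m, n)) (B : T -> 'M[R]_(n, l)) :
  mx_measurable A -> mx_measurable B -> mx_measurable (fun w => A w *m B w).
Proof.
move=> mA mB i j; under eq_fun do rewrite mxE.
by apply: measurable_sum => k; apply: measurable_funM.
Qed.

Lemma mx_measurable_sum m n (I : finType) (A : I -> T -> 'M[R]_(m, n)) :
  (forall i, mx_measurable (A i)) -> mx_measurable (fun w => \sum_i A i w).
Proof.
move=> mA i j; under eq_fun do rewrite summxE.
by apply: measurable_sum => k; apply: mA.
Qed.

Lemma measurable_dotv p (u v : T -> 'cV[R]_p) : mx_measurable u ->
  mx_measurable v -> measurable_fun [set: T] (fun w => dotv (u w) (v w)).
Proof.
move=> mu mv; under eq_fun do rewrite dotvE.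
by apply: measurable_sum => k; apply: measurable_funM.
Qed.

Lemma measurable_enorm p (u : T -> 'cV[R]_p) : mx_measurable u ->
  measurable_fun [set: T] (fun w => enorm (u w)).
Proof.
move=> mu.
apply: (measurableT_comp (continuous_measurable_fun (@sqrt_continuous R))).
by apply: measurable_sum => k; apply: measurable_funX.
Qed.

Lemma measurable_det n (A : T -> 'M[R]_n) :
  mx_measurable A -> measurable_fun [set: T] (fun w => \det (A w)).
Proof.
move=> mA; apply: measurable_sum => s; apply: measurable_funM.
  exact: measurable_cst.
by apply: measurable_prod => i _; apply: mA.
Qed.

(** Cramer's rule: the entries of the inverse are rational in those of [A w]. *)
Lemma mx_measurable_inv n (A : T -> 'M[R]_n) :
  mx_measurable A -> mx_measurable (fun w => invmx (A w)).
Proof.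
move=> mA i j.
have madj : measurable_fun [set: T] (fun w => \adj (A w) i j).
  under eq_fun do rewrite mxE.
  apply: measurable_funM; first exact: measurable_cst.
  by apply: measurable_det => k l; under eq_fun do rewrite !mxE; apply: mA.
have -> : (fun w => invmx (A w) i j) = (fun w =>
    if \det (A w) != 0 then (\det (A w))^-1 * \adj (A w) i j else A w i j).
  by apply/funext => w; rewrite /invmx unitmxE unitfE; case: ifP; rewrite ?mxE.
apply: measurable_fun_if => //=.
- apply: measurable_neg; apply: measurable_fun_eqr => //.
  exact: measurable_det.
- apply: measurable_funS (measurable_funM _ madj) => //.
  by apply/measurable_inv/measurable_det.
- by apply: measurable_funS (mA i j).
Qed.

End MeasurableMatrices.

Lemma measure_fin_union_le d (T : measurableType d) (R : realType)
    (mu : {measure set T -> \bar R}) (I : finType) (A : set T)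
    (B : I -> set T) :
  measurable A -> (forall i, measurable (B i)) ->
  (forall w, A w -> exists i, B i w) -> (mu A <= \sum_i mu (B i))%E.
Proof.
move=> mA mB AB.
have mU s : measurable (\big[setU/set0]_(i <- s) B i).
  by apply: bigsetU_measurable.
apply: (@le_trans _ _ (mu (\big[setU/set0]_i B i))).
  apply: le_measure; rewrite ?inE// => w /AB[i Bi].
  by rewrite (bigD1 i)//=; left.
elim: (index_enum I) => [|i s IH]; first by rewrite !big_nil measure0.
rewrite !big_cons; apply: le_trans (leeD2l _ IH).
exact: measureU2.
Qed.

Section ConditionalProbability.
Context {d : measure_display} {T : measurableType d} {R : realType}.
Variable P : probability T R.
Variable G : set (set T).
Local Notation F := (<<s G >>).
Hypothesis F_sub : F `<=` measurable.

Lemma is_cond_prob_measurable A (g : T -> R) :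
  is_cond_prob P F A g -> measurable_fun [set: T] g.
Proof.
move=> [gF _ _] _ C mC; rewrite setTI; apply: F_sub; apply: gF; exact: mC.
Qed.

(** [I] indexes the outcomes of a randomization with conditional probabilities
    [g i]; on the event that [i] is drawn, [A] can only happen inside an event
    [B i] that the conditioning information decides.  Summing over the outcomes
    replaces a conditional expectation by a pointwise finite sum. *)
Lemma measure_randomized_le (I : finType) (A E D : set T) (C B : I -> set T)
    (g : I -> T -> R) (e : R) :
  measurable A -> F E -> F D -> D `<=` E ->
  (forall i, measurable (C i)) -> (forall w, exists i, C i w) ->
  (forall i, is_cond_prob P F (C i) (g i)) -> (forall i w, 0 <= g i w) ->
  (forall i, F (B i)) ->
  (forall i, A `&` E `&` C i `<=` B i) ->
  (forall w, E w -> \sum_(i | w \in B i) g i w <= e) ->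
  (P (A `&` D) <= e%:E * P D)%E.
Proof.
move=> mA FE FD DE mC Ccover Cg g0 FB AB gB.
have mD := F_sub FD.
have FDB i : F (D `&` B i).
  exact: (@measurableI _ (g_sigma_algebraType G) _ _ FD (FB i)).
have mDB i := F_sub (FDB i).
apply: (@le_trans _ _ (\sum_i P (C i `&` (D `&` B i)))%E).
  apply: measure_fin_union_le => [|i|w [Aw Dw]]; [exact: measurableI..|].
  have [i Ciw] := Ccover w; exists i; split => //; split => //.
  by apply: AB; do 2!split => //; apply: DE.
have mg i : measurable_fun D (EFin \o g i).
  apply/measurable_EFinP; apply: measurable_funTS.
  exact: is_cond_prob_measurable (Cg i).
have mgB i : measurable_fun D ((EFin \o g i) \_ (B i)).
  apply/measurable_restrict => //; first exact: F_sub.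
  by apply: measurable_funS (mg i) => // w [].
have gB0 i w : (0 <= ((EFin \o g i) \_ (B i)) w)%E.
  by rewrite patchE; case: ifP => //= _; rewrite lee_fin.
have -> : (\sum_i P (C i `&` (D `&` B i)) =
    \int[P]_(w in D) \sum_i ((EFin \o g i) \_ (B i)) w)%E.
  rewrite ge0_integral_sum//; apply: eq_bigr => i _.
  by have [_ _ /(_ _ (FDB i)) <-] := Cg i; rewrite integral_mkcondr.
rewrite -integral_cst//; apply: ge0_le_integral => //.
- by move=> w _; apply: sume_ge0.
- exact: emeasurable_sum.
- move=> w Dw /=.
  have -> : (\sum_i ((EFin \o g i) \_ (B i)) w)%E =
      (\sum_(i | w \in B i) g i w)%:E.
    rewrite -sumEFin [RHS]big_mkcond/=; apply: eq_bigr => i _.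
    by rewrite patchE.
  by rewrite lee_fin gB//; apply: DE.
Qed.

(** Test the defining identity of a conditional probability on the part of [E]
    where it is large. *)
Lemma cond_prob_lt_ae (A E : set T) (g : T -> R) (e' e : R) :
  is_cond_prob P F A g -> F E -> e' < e ->
  (forall D, F D -> D `<=` E -> (P (A `&` D) <= e'%:E * P D)%E) ->
  P (E `&` [set w | e <= g w]) = 0%E.
Proof.
move=> Ag FE ee' AE; set D := _ `&` _.
have mg := is_cond_prob_measurable Ag.
have FD : F D.
  apply: (@measurableI _ (g_sigma_algebraType G)) => //.
  have [+ _ _] := Ag => /(_ `[e, +oo[%classic (measurable_itv _)).
  by congr F; apply/seteqP; split => w /=; rewrite in_itv/= andbT.
have mD := F_sub FD.
have [gF gint gE] := Ag.
have := AE D FD (@subIsetl _ _ _); rewrite -gE// => Dle.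
have eD : (e%:E * P D <= \int[P]_(w in D) (g w)%:E)%E.
  rewrite -integral_cst//; apply: le_integral => //.
  - exact/finite_measure_integrable_cst.
  - exact: integrableS gint.
  - by move=> w; rewrite inE /D/= => -[_ +]; rewrite lee_fin.
have := le_trans eD Dle.
have /fineK <- := fin_num_measure P D mD.
rewrite -!EFinM lee_fin => eP; congr EFin.
have P0 : 0 <= fine (P D) by rewrite fine_ge0.
by apply/eqP; rewrite eq_le P0 andbT -(@pmulr_rle0 _ (e - e')) ?subr_gt0//; lra.
Qed.

End ConditionalProbability.

(** * Good datasets *)

Section GoodDataset.
Context {R : realType} {p : nat}.
Implicit Types (H S : 'M[R]_p) (lam : R).

Definition tolerance lam : R := lam / (4 * p.+1%:R).

Lemma tolerance_gt0 lam : 0 < lam -> 0 < tolerance lam.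
Proof. by move=> lam0; rewrite divr_gt0// mulr_gt0. Qed.

(** The margin [tolerance lam * p%:R] is kept for a second perturbation of the
    same size, from the full-data Hessian to the subsample one. *)
Lemma coercive_HW_near lam H S n (W : nat -> 'cV[R]_p) :
  0 < lam -> coercive lam H ->
  (forall i j, `|HW n W S i j - H i j| < tolerance lam) ->
  coercive (lam / 2 + tolerance lam * p%:R) (HW n W S).
Proof.
move=> lam0 cH near u.
have := coercive_perturb cH (fun i j => ltW (near i j)) u; apply: le_trans.
rewrite ler_wpM2r ?dotv_ge0//.
have : tolerance lam * p%:R <= lam / 4.
  rewrite /tolerance invfM mulrA -mulrA ler_piMr ?divr_ge0 ?(ltW lam0)//.
  by rewrite mulrC ler_pdivrMr// mul1r ler_nat.
lra.
Qed.

(** The residuals are taken at [argmin_formula] and not at a minimizer chosen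
    from outside, so that this property is decided by the data. *)
Definition good n (W : nat -> 'cV[R]_p) (y q : nat -> R) H S lam (M : R) :=
  [/\ forall i j, `|HW n W S i j - H i j| < tolerance lam,
      n%:R^-1 * \sum_(i < n) enorm (W i) ^+ 4 <= M,
      n%:R^-1 * \sum_(i < n) (y i - dotv (W i) (argmin_formula n W y S)) ^+ 4
        <= M
    & forall i : 'I_n, 1 <= M * (n%:R * q i)].

Lemma argmin_full_loss_near n (W : nat -> 'cV[R]_p) y H S lam b :
  S^T = S -> 0 < lam -> coercive lam H ->
  (forall i j, `|HW n W S i j - H i j| < tolerance lam) ->
  argmin_spec (full_loss n W y S) b -> b = argmin_formula n W y S.
Proof.
move=> ST lam0 cH /(coercive_HW_near lam0 cH) cHW.
apply: argmin_full_loss cHW => //.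
by rewrite ltr_wpDr ?divr_gt0// mulr_ge0// ltW ?tolerance_gt0.
Qed.

(** The bound of [prob_deviation_le] for the constants used below: the first
    term is for the Hessian and decreases with [r], the second is for the score
    and decreases with [Delta]. *)
Definition rate_bound lam (M Delta : R) (r : nat) : R :=
  p%:R ^+ 2 * M ^+ 2 / (r%:R * tolerance lam ^+ 2)
  + p%:R * M ^+ 2 / (lam / 2 * Delta) ^+ 2.

Lemma rate_bound_small lam M (e : R) : 0 < lam -> 0 < e ->
  exists Delta r0, 0 < Delta /\
    forall r, (r0 < r)%N -> rate_bound lam M Delta r < e.
Proof.
move=> lam0 e0.
have small a c : 0 <= a -> 0 < c ->
    exists N : nat, forall x : R, N%:R <= x -> 0 < x /\ a / (x * c) < e / 2.
  move=> a0 c0; exists (Num.bound (2 * a / (c * e))).+1 => x Nx.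
  have x0 : 0 < x by apply: lt_le_trans Nx; rewrite ltr0n.
  split => //; rewrite ltr_pdivrMr ?mulr_gt0//.
  have : 2 * a / (c * e) < x.
    apply: lt_le_trans Nx.
    apply: (@lt_trans _ _ (Num.bound (2 * a / (c * e)))%:R).
      by apply: archi_boundP; rewrite divr_ge0 ?mulr_ge0// ltW// mulr_gt0.
    by rewrite ltr_nat.
  rewrite ltr_pdivrMr ?mulr_gt0//; lra.
have [|N1 small1] := small (p%:R ^+ 2 * M ^+ 2) (tolerance lam ^+ 2) _
  (exprn_gt0 _ (tolerance_gt0 lam0)).
  by rewrite mulr_ge0 ?sqr_ge0.
have l2 : 0 < (lam / 2) ^+ 2 by rewrite exprn_gt0// divr_gt0.
have [|N2 small2] := small (p%:R * M ^+ 2) ((lam / 2) ^+ 2) _ l2.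
  by rewrite mulr_ge0 ?sqr_ge0.
exists (N2.+1%:R), N1; split; first by rewrite ltr0n.
move=> r N1r; rewrite /rate_bound [e]splitr ltrD//.
  by have [|] := small1 r%:R; first by rewrite ler_nat ltnW.
rewrite exprMn [X in _ / X]mulrC.
have [|//] := small2 (N2.+1%:R ^+ 2).
by rewrite -natrX ler_nat (leq_trans (leqnSn _))// leq_pmulr.
Qed.

End GoodDataset.

Section MeasurableEstimation.
Context {d : measure_display} {T : measurableType d} {R : realType} {p : nat}.
Variables (n : nat) (W : nat -> T -> 'cV[R]_p) (y q : nat -> T -> R).
Hypothesis mW : forall i, (i < n)%N -> mx_measurable (W i).
Hypothesis my : forall i, (i < n)%N -> measurable_fun [set: T] (y i).
Variable S : 'M[R]_p.

Lemma mx_measurable_HW : mx_measurable (fun w => HW n (W ^~ w) S).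
Proof.
apply: mx_measurableD; last exact: mx_measurable_cst.
apply: (@mx_measurableZ _ _ _ _ _ (fun=> _)); first exact: measurable_cst.
apply: mx_measurable_sum => i; apply: mx_measurableM; first exact: mW.
by apply: mx_measurable_tr; apply: mW.
Qed.

Lemma mx_measurable_argmin_formula :
  mx_measurable (fun w => argmin_formula n (W ^~ w) (y ^~ w) S).
Proof.
apply: mx_measurableM; first exact/mx_measurable_inv/mx_measurable_HW.
apply: (@mx_measurableZ _ _ _ _ _ (fun=> _)); first exact: measurable_cst.
by apply: mx_measurable_sum => i; apply: mx_measurableZ; [apply: my|apply: mW].
Qed.

Lemma measurable_mean_pow4 (f : nat -> T -> R) :
  (forall i, (i < n)%N -> measurable_fun [set: T] (f i)) ->
  measurable_fun [set: T] (fun w => n%:R^-1 * \sum_(i < n) f i w ^+ 4).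
Proof.
move=> mf; apply: measurable_funM; first exact: measurable_cst.
by apply: measurable_sum => i; apply: measurable_funX; apply: mf.
Qed.

Lemma measurable_residual (b : T -> 'cV[R]_p) i : (i < n)%N ->
  mx_measurable b ->
  measurable_fun [set: T] (fun w => y i w - dotv (W i w) (b w)).
Proof.
move=> ni mb; apply: measurable_funB; first exact: my.
by apply: measurable_dotv => //; apply: mW.
Qed.

Hypothesis mq : forall i, (i < n)%N -> measurable_fun [set: T] (q i).

Lemma measurable_good H lam M :
  measurable [set w | good n (W ^~ w) (y ^~ w) (q ^~ w) H S lam M].
Proof.
rewrite (_ : mkset _ =
  [set w | forall i j, `|HW n (W ^~ w) S i j - H i j| < tolerance (p := p) lam]
  `&` [set w | n%:R^-1 * \sum_(i < n) enorm (W i w) ^+ 4 <= M]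
  `&` [set w | n%:R^-1 * \sum_(i < n) (y i w - dotv (W i w)
         (argmin_formula n (W ^~ w) (y ^~ w) S)) ^+ 4 <= M]
  `&` [set w | forall i : 'I_n, 1 <= M * (n%:R * q i w)]); last first.
  by apply/seteqP; split => w; [case | case=> -[[]]].
apply: measurableI; first (apply: measurableI; first apply: measurableI).
- apply: measurable_forall => i; apply: measurable_forall => j.
  apply: measurable_set_lt; last exact: measurable_cst.
  apply: (measurableT_comp (@normr_measurable R setT)).
  apply: measurable_funB; last exact: measurable_cst.
  exact: mx_measurable_HW.
- apply: measurable_set_le; last exact: measurable_cst.
  apply: (measurable_mean_pow4 (f := fun i w => enorm (W i w))) => i ni.
  by apply: measurable_enorm; apply: mW.
- apply: measurable_set_le; last exact: measurable_cst.
  apply: (measurable_mean_pow4 (f := fun i w => y i w - dotv (W i w)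
    (argmin_formula n (W ^~ w) (y ^~ w) S))) => i ni.
  apply: measurable_residual => //.
  exact: mx_measurable_argmin_formula.
- apply: measurable_forall => i; apply: measurable_set_le.
    exact: measurable_cst.
  apply: measurable_funM; first exact: measurable_cst.
  by apply: measurable_funM; [exact: measurable_cst|apply: mq].
Qed.

Lemma measurable_deviation r (eta c : R) (b : T -> 'cV[R]_p) (k : 'I_r -> nat) :
  (forall j, (k j < n)%N) -> mx_measurable b ->
  measurable_fun [set: T]
    (fun w => deviation n (W ^~ w) (y ^~ w) S (q ^~ w) eta c (b w) k).
Proof.
move=> kn mb.
have mom j : measurable_fun [set: T] (fun w => ipw n (q ^~ w) k j).
  apply: measurable_inv; apply: measurable_funM; first exact: measurable_cst.
  by apply: measurable_funM; [exact: measurable_cst|apply: mq].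
have mH : mx_measurable (fun w => sub_hess n (W ^~ w) S (q ^~ w) k).
  apply: mx_measurableD; last exact: mx_measurable_cst.
  apply: mx_measurable_sum => j; apply: mx_measurableZ => //.
  by apply: mx_measurableM; [|apply: mx_measurable_tr]; apply: mW.
have ms : mx_measurable
    (fun w => sub_score n (W ^~ w) (y ^~ w) S (q ^~ w) k (b w)).
  apply: mx_measurableD; last first.
    by apply: mx_measurableM => //; apply: mx_measurable_cst.
  apply: mx_measurable_sum => j; apply: mx_measurableZ; last exact: mW.
  by apply: measurable_funM => //; apply: measurable_residual.
apply: measurable_funD; apply: measurable_funM; try exact: measurable_cst.
  apply: measurable_sum => i; apply: measurable_sum => j.
  apply: measurable_funX; apply: measurable_funB; first exact: mH.
  exact: mx_measurable_HW.
apply: measurable_funM; first exact: measurable_cst.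
exact: measurable_dotv.
Qed.

End MeasurableEstimation.

(** * The rate in conditional probability *)

Section DataSigmaAlgebra.
Context {d : measure_display} {T : measurableType d} {R : realType} {p : nat}.
Variables (W : nat -> T -> 'cV[R]_p) (y : nat -> T -> R).

(** Naming the generators of [sigma_data W y n] gives a name to the measurable
    type that they generate, in which measurability means being decided by the
    first [n] data points. *)
Definition data_events n : set (set T) :=
  \bigcup_(i in [set i : nat | (i < n)%N])
    (sigma_vec (W i) `|` sigma_fun (y i)).

Lemma sigma_data_measurable n : (forall i, random_vector (W i)) ->
  (forall i, measurable_fun [set: T] (y i)) ->
  sigma_data W y n `<=` measurable.
Proof.
move=> mW my; apply: smallest_sub; first exact: sigma_algebra_measurable.
move=> A [i _] [|]; apply: smallest_sub A; try exact: sigma_algebra_measurable.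
  by move=> A [j _] [B mB <-]; apply: mW.
by move=> A [B mB <-]; apply: my.
Qed.

Lemma data_vec_measurable n i : (i < n)%N ->
  @mx_measurable _ (g_sigma_algebraType (data_events n)) R _ _ (W i).
Proof.
move=> ni j k _ B mB; rewrite ord1; apply: sub_sigma_algebra.
exists i => //; left; apply: sub_sigma_algebra; exists j => //.
by exists B.
Qed.

Lemma data_response_measurable n i : (i < n)%N ->
  @measurable_fun _ _ (g_sigma_algebraType (data_events n)) _ [set: T] (y i).
Proof.
move=> ni _ B mB; apply: sub_sigma_algebra.
exists i => //; right; apply: sub_sigma_algebra.
by exists B.
Qed.

End DataSigmaAlgebra.

Section ConditionalRate.
Context {d : measure_display} {T : measurableType d} {R : realType} {p : nat}.
Variable P : probability T R.
Variables (W : nat -> T -> 'cV[R]_p) (y : nat -> T -> R).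
Hypothesis mW : forall i, random_vector (W i).
Hypothesis my : forall i, measurable_fun [set: T] (y i).
Variables (H S : 'M[R]_p) (lam : R).
Hypotheses (S_sym : S^T = S) (lam_gt0 : 0 < lam) (H_coercive : coercive lam H).
Variables (n : nat) (q : nat -> T -> R).
Hypothesis n_gt0 : (0 < n)%N.
Hypothesis q_ge0 : forall i w, (i < n)%N -> 0 <= q i w.
Hypothesis q_sum : forall w, \sum_(i < n) q i w = 1.

Let good_event M := [set w | good n (W ^~ w) (y ^~ w) (q ^~ w) H S lam M].

(** For a fixed sequence [k] of draws, [argmin_sub_loss_near] shows that the
    estimators can only be far apart on a good dataset whose deviation at [k] is
    at least [1], which is an event of the data; [prob_deviation_le] bounds the
    total probability of these sequences. *)
Lemma cond_prob_rate r (K : 'I_r -> T -> nat) (bhat btil : T -> 'cV[R]_p)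
    (M Delta e : R) (g : T -> R) :
  (0 < r)%N -> 0 <= M -> 0 < Delta ->
  (forall i, (i < n)%N ->
    @measurable_fun _ _ (g_sigma_algebraType (data_events W y n)) _
      [set: T] (q i)) ->
  (forall j k, measurable [set w | K j w = k]) ->
  (forall j w, (K j w < n)%N) ->
  (forall k : 'I_r -> 'I_n, is_cond_prob P (sigma_data W y n)
    [set w | forall j : 'I_r, K j w = k j]
    (fun w => \prod_(j < r) q (k j) w)) ->
  random_vector bhat -> random_vector btil ->
  (forall w, argmin_spec (full_loss n (W ^~ w) (y ^~ w) S) (bhat w)) ->
  (forall w,
    argmin_spec (sub_loss n (W ^~ w) (y ^~ w) (q ^~ w) (K ^~ w) S) (btil w)) ->
  is_cond_prob P (sigma_data W y n)
    [set w | (Num.sqrt r%:R)^-1 * Delta <= enorm (btil w - bhat w)] g ->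
  rate_bound (p := p) lam M Delta r < e ->
  P (good_event M `&` [set w | e <= g w]) = 0%E.
Proof.
move=> r0 M0 Delta0 mq mK K_lt K_law mbhat mbtil bhatE btilE Ag small.
have F_sub := sigma_data_measurable (n := n) mW my.
have FG : sigma_data W y n (good_event M).
  exact: (@measurable_good _ (g_sigma_algebraType (data_events W y n)) _ _ n
    W y q (@data_vec_measurable _ _ _ _ W y n)
    (@data_response_measurable _ _ _ _ W y n) S mq H lam M).
apply: (cond_prob_lt_ae F_sub Ag FG small) => D FD DG.
pose k0 w (j : 'I_r) : 'I_n := Ordinal (K_lt j w).
pose dev w (k : {ffun 'I_r -> 'I_n}) :=
  deviation n (W ^~ w) (y ^~ w) S (q ^~ w) (tolerance (p := p) lam)
    (lam / 2 * Delta) (argmin_formula n (W ^~ w) (y ^~ w) S) (fun j => k j).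
have l2 : 0 < lam / 2 by rewrite divr_gt0.
have tol0 : 0 < tolerance (p := p) lam by apply: tolerance_gt0.
apply: (measure_randomized_le F_sub (E := good_event M)
  (C := fun k : {ffun 'I_r -> 'I_n} => [set w | forall j : 'I_r, K j w = k j])
  (B := fun k => [set w | 1 <= dev w k])
  (g := fun k w => \prod_(j < r) q (k j) w)) => //.
- apply: measurable_set_le; first exact: measurable_cst.
  apply: measurable_enorm; apply: mx_measurableD => [i j|].
    by rewrite ord1; apply: mbtil.
  by apply: mx_measurableN => i j; rewrite ord1; apply: mbhat.
- move=> k.
  by apply: (measurable_forall (A := fun j => [set w | K j w = k j])).
- by move=> w; exists [ffun j => k0 w j] => j; rewrite ffunE.
- by move=> k w; rewrite prodr_ge0// => j _; apply: q_ge0.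
- move=> k; apply: (@measurable_set_le _
    (g_sigma_algebraType (data_events W y n)) R (fun=> 1)).
    exact: measurable_cst.
  apply: (@measurable_deviation _ (g_sigma_algebraType (data_events W y n)) _ _
    n W y q _ _ S mq) => //.
  + exact: data_vec_measurable.
  + exact: data_response_measurable.
  + apply: (@mx_measurable_argmin_formula _
      (g_sigma_algebraType (data_events W y n))).
      exact: data_vec_measurable.
    exact: data_response_measurable.
- move=> k w [[far [near _ _ _]] Kk] /=; rewrite leNgt; apply/negP => dev1.
  have bw := argmin_full_loss_near S_sym lam_gt0 H_coercive near (bhatE w).
  have := btilE w; rewrite (_ : K ^~ w = fun j => k j); last first.
    by apply/funext => j; rewrite Kk.
  move=> bt; have := argmin_sub_loss_near S_sym r0 l2 tol0 Delta0
    (coercive_HW_near lam_gt0 H_coercive near) bt dev1.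
  by rewrite -bw ltNge => /negP; apply.
- move=> w [near W4 y4 qM].
  apply: le_trans (prob_deviation_le n_gt0 r0 (W := W ^~ w) (y := y ^~ w)
    (S := S) (q := q ^~ w) (tolerance (p := p) lam) (lam / 2 * Delta)
    _ _ _ M0 W4 y4 _) => //.
  + rewrite le_eqVlt; apply/orP; left; apply/eqP.
    by apply: eq_bigl => k; apply/idP/idP => [|dev1]; rewrite inE.
  + by move=> i ni; apply: q_ge0.
  + by move=> i ni; apply: (qM (Ordinal ni)).
  + apply: full_score_argmin_formula.
    apply: coercive_unitmx (coercive_HW_near lam_gt0 H_coercive near).
    by rewrite ltr_wpDr// mulr_ge0// ltW.
Qed.

End ConditionalRate.

(** * Good datasets are likely *)

Lemma union_eventually_small d (T : measurableType d) (R : realType)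
    (P : probability T R) (I : finType) (B : I -> nat -> set T) (delta : R) :
  0 < delta -> (forall i n, measurable (B i n)) ->
  (forall i, exists N, forall n, (N <= n)%N ->
    (P (B i n) < (delta / #|I|.+1%:R)%:E)%E) ->
  exists N, forall n, (N <= n)%N -> forall A, measurable A ->
    (forall w, A w -> exists i, B i n w) -> (P A < delta%:E)%E.
Proof.
move=> delta0 mB /choice[N NB]; exists (\max_i N i)%N => n Nn A mA AB.
apply: (le_lt_trans (measure_fin_union_le P mA (B := B ^~ n) _ AB)) => //.
apply: (@le_lt_trans _ _ (\sum_(i : I) (delta / #|I|.+1%:R)%:E)%E).
  by apply: lee_sum => i _; apply/ltW/NB/(leq_trans _ Nn)/leq_bigmax.
rewrite sumEFin lte_fin sumr_const -[ltLHS]mulr_natr mulrAC.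
rewrite ltr_pdivrMr ?ltr0n//.
by rewrite ltr_pM2l// ltr_nat.
Qed.

(** A zero weight makes the maximum infinite and satisfies the right-hand side
    whatever [M] is, which matches the convention [0^-1 = +oo]. *)
Lemma lt_max_inv_weight (R : realType) (n : nat) (q : nat -> R) (M : R) :
  (0 < n)%N -> (forall i, (i < n)%N -> 0 <= q i) ->
  (M%:E < `|\big[maxe/0]_(i < n) ((n%:R * q i)%:E)^-1|)%E <->
  exists i : 'I_n, M * (n%:R * q i) < 1.
Proof.
move=> n0 q0.
have nq0 (i : 'I_n) : 0 <= n%:R * q i by rewrite mulr_ge0// q0.
rewrite gee0_abs; last by apply: bigmax_ge_id.
have [M0|M0] := ltP M 0.
  split => _.
    by exists (Ordinal n0); rewrite (le_lt_trans _ ltr01)// mulr_le0_ge0// ltW.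
  by apply: lt_le_trans (bigmax_ge_id _ _ _ _); rewrite lte_fin.
have inv_lt (i : 'I_n) :
    (M%:E < ((n%:R * q i)%:E)^-1)%E = (M * (n%:R * q i) < 1).
  rewrite inver; case: eqVneq => [->|nz]; first by rewrite mulr0 ltr01 ltry.
  by rewrite lte_fin -[X in _ < X]mul1r ltr_pdivlMr// lt_neqAle eq_sym nz nq0.
split=> [|[i iM]].
  rewrite ltNge => /negP Mmax; apply/not_existsP => iM; apply: Mmax.
  apply/bigmax_leP; split => [|i _]; first by rewrite lee_fin.
  by rewrite leNgt inv_lt; apply/negP/iM.
apply: (@lt_le_trans _ _ (((n%:R * q i)%:E)^-1)%E); first by rewrite inv_lt.
exact: (le_bigmax _ (fun i : 'I_n => ((n%:R * q i)%:E)^-1)%E).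
Qed.

Section GoodEventLikely.
Context {d : measure_display} {T : measurableType d} {R : realType} {p : nat}.
Variable P : probability T R.
Variables (W : nat -> T -> 'cV[R]_p) (y : nat -> T -> R).
Hypothesis mW : forall i, random_vector (W i).
Hypothesis my : forall i, measurable_fun [set: T] (y i).
Variables (H S : 'M[R]_p) (lam : R).
Hypotheses (S_sym : S^T = S) (lam_gt0 : 0 < lam) (H_coercive : coercive lam H).
Variable q : nat -> nat -> T -> R.
Hypothesis mq : forall n i, (i < n)%N -> measurable_fun [set: T] (q n i).
Hypothesis q_ge0 : forall n i w, (i < n)%N -> 0 <= q n i w.
Variable bhat : nat -> T -> 'cV[R]_p.
Hypothesis mbhat : forall n, random_vector (bhat n).
Hypothesis bhatE : forall n w,
  argmin_spec (full_loss n (W ^~ w) (y ^~ w) S) (bhat n w).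
Hypothesis A1 : mx_cvg_in_prob P (fun n w => HW n (W ^~ w) S) H.
Hypothesis A2W : OP1 P (fun n w =>
  (n%:R^-1 * \sum_(i < n) enorm (W i w) ^+ 4)%:E).
Hypothesis A2y : OP1 P (fun n w =>
  (n%:R^-1 * \sum_(i < n) (y i w - dotv (W i w) (bhat n w)) ^+ 4)%:E).
Hypothesis A3 : OP1 P (fun n w =>
  (\big[maxe/0]_(i < n) ((n%:R * q n i w)%:E)^-1)%E).

Let good_event n M := [set w | good n (W ^~ w) (y ^~ w) (q n ^~ w) H S lam M].

Let mW' i : mx_measurable (W i).
Proof. by move=> j k; rewrite ord1; apply: mW. Qed.

Lemma measurable_good_event n M : measurable (good_event n M).
Proof. by apply: measurable_good => // i; apply: mq. Qed.

Let measurable_tail (f : T -> R) (M : R) : measurable_fun [set: T] f ->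
  measurable [set w | (M%:E < `|(f w)%:E|)%E].
Proof.
move=> mf; apply: measurable_set_lt; first exact: measurable_cst.
exact: (measurableT_comp (@normr_measurable R setT)).
Qed.

(** The complement of the good event is covered by finitely many bad ones.  The
    hypotheses on residuals concern [bhat], which equals [argmin_formula] as soon
    as the Hessian is near [H]. *)
Lemma good_event_likely (delta : R) : 0 < delta ->
  exists M N : nat, forall n, (N <= n)%N ->
    (P (~` good_event n M%:R) < delta%:E)%E.
Proof.
move=> delta0.
(* Indices of the bad events: residuals and weights get one each, so do the
   covariates, and the Hessian gets one for each entry. *)
pose I := option (option (option ('I_p * 'I_p))).
pose delta' := delta / #|{: I}|.+1%:R.
have delta'0 : 0 < delta' by rewrite divr_gt0.
have [M1 [N1 W4]] := A2W delta'0.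
have [M2 [N2 y4]] := A2y delta'0.
have [M3 [N3 qM]] := A3 delta'0.
pose avgW n w := n%:R^-1 * \sum_(i < n) enorm (W i w) ^+ 4.
pose avgy n w :=
  n%:R^-1 * \sum_(i < n) (y i w - dotv (W i w) (bhat n w)) ^+ 4.
pose B (t : I) n : set T := match t with
  | None => [set w | (M1%:E < `|(avgW n w)%:E|)%E]
  | Some None => [set w | (M2%:E < `|(avgy n w)%:E|)%E]
  | Some (Some None) => [set w | exists i : 'I_n, M3 * (n%:R * q n i w) < 1]
  | Some (Some (Some (i, j))) =>
      [set w | tolerance (p := p) lam <= `|HW n (W ^~ w) S i j - H i j|]
  end.
have mB t n : measurable (B t n).
  case: t => [[[[i j]|]|]|] /=.
  - apply: measurable_set_le; first exact: measurable_cst.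
    apply: (measurableT_comp (@normr_measurable R setT)).
    apply: measurable_funB; last exact: measurable_cst.
    exact: mx_measurable_HW.
  - rewrite (_ : mkset _ =
        ~` [set w | forall i : 'I_n, 1 <= M3 * (n%:R * q n i w)]); last first.
      apply/seteqP; split => w /=.
        by move=> [i iM] /(_ i); rewrite leNgt iM.
      by move=> /existsNP[i /negP]; rewrite -ltNge; exists i.
    apply: measurableC; apply: measurable_forall => i; apply: measurable_set_le.
      exact: measurable_cst.
    apply: measurable_funM; first exact: measurable_cst.
    by apply: measurable_funM; [exact: measurable_cst|apply: mq].
  - apply: measurable_tail.
    apply: (measurable_mean_pow4
      (f := fun i w => y i w - dotv (W i w) (bhat n w))) => i ni.
    apply: (measurable_residual (n := n)) => // j k.
    by rewrite ord1; apply: mbhat.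
  - apply: measurable_tail.
    apply: (measurable_mean_pow4 (f := fun i w => enorm (W i w))) => i ni.
    exact: measurable_enorm.
have Bsmall t : exists N, forall n, (N <= n)%N -> (P (B t n) < delta'%:E)%E.
  case: t => [[[[i j]|]|]|] /=.
  - have near0 : nbhs 0%E [set u : \bar R | (u < delta'%:E)%E].
      apply: open_nbhs_nbhs; split => /=; last by rewrite lte_fin.
      exact: open_ereal_lt_ereal.
    have [N _ NP] := A1 i j (tolerance_gt0 (p := p) lam_gt0) near0.
    by exists N => n Nn; apply: (NP n).
  - exists (maxn N3 1) => n; rewrite geq_max => /andP[N3n n0].
    rewrite (_ : mkset _ = [set w | (M3%:E < `|\big[maxe/0]_(i < n)
      ((n%:R * q n i w)%:E)^-1|)%E]); first exact: qM.
    have tailE w := lt_max_inv_weight M3 n0 (fun i => @q_ge0 n i w).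
    by apply/seteqP; split => w /= /tailE.
  - by exists N2.
  - by exists N1.
have [N NP] := union_eventually_small delta0 mB Bsmall.
pose M := (Num.bound M1 + Num.bound M2 + Num.bound M3)%N.
have M_ge x : x = M1 \/ x = M2 \/ x = M3 -> x <= M%:R.
  move=> xM; apply: le_trans (ler_norm x) _.
  apply: le_trans (ltW (archi_boundP (normr_ge0 x))) _.
  rewrite ler_nat /M.
  have <- : Num.bound x = Num.bound `|x| by rewrite /Num.bound normr_id.
  case: xM => [|[]] ->; rewrite ?leq_addl// -?addnA ?leq_addr//.
  by rewrite addnCA leq_addr.
exists M, N => n Nn; apply: (NP n Nn).
  exact/measurableC/measurable_good_event.
move=> w bad; apply: contrapT => /forallNP notB; apply: bad.
have near i j : `|HW n (W ^~ w) S i j - H i j| < tolerance (p := p) lam.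
  by rewrite ltNge; apply/negP; apply: (notB (Some (Some (Some (i, j))))).
have le_M (x z : R) : z <= M%:R -> ~ (z%:E < `|x%:E|)%E -> x <= M%:R.
  move=> zM /negP; rewrite -leNgt lee_fin => xz.
  by apply: le_trans (ler_norm x) (le_trans xz zM).
split => //.
- by apply: le_M (notB None); apply: M_ge; left.
- rewrite -(argmin_full_loss_near S_sym lam_gt0 H_coercive near (@bhatE n w)).
  by apply: le_M (notB (Some None)); apply: M_ge; right; left.
- move=> i; rewrite leNgt; apply/negP => iM.
  apply: (notB (Some (Some None))); exists i; apply: le_lt_trans iM.
  by rewrite ler_wpM2r ?mulr_ge0 ?q_ge0// M_ge//; right; right.
Qed.

End GoodEventLikely.

(** * Consistency of the subsample estimator *)

Theorem theorem1
  (d : measure_display) (T : measurableType d) (R : realType)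
  (P : probability T R) (p : nat)
  (* measurement error model *)
  (X U W : nat -> T -> 'cV[R]_p) (eps y : nat -> T -> R)
  (beta : 'cV[R]_p) (sigma : R) (Sigma : 'M[R]_p)
  (mX : forall i, random_vector (X i))
  (mU : forall i, random_vector (U i))
  (meps : forall i, measurable_fun [set: T] (eps i))
  (yE : forall i w, y i w = dotv (X i w) beta + eps i w)
  (WE : forall i w, W i w = X i w + U i w)
  (eps_mean : forall i, ('E_P[eps i] = 0)%E)
  (eps_var : forall i, ('V_P[eps i] = (sigma ^+ 2)%:E)%E)
  (U_mean : forall i j, ('E_P[fun w => U i w j 0%R] = 0)%E)
  (U_cov : forall i j k,
    covariance P (fun w => U i w j 0) (fun w => U i w k 0) = (Sigma j k)%:E)
  (U_eps : forall i, indep P (sigma_vec (U i)) (sigma_fun (eps i)))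
  (U_X : forall i, indep P (sigma_vec (U i)) (sigma_vec (X i)))
  (* full-data estimator *)
  (bhat : nat -> T -> 'cV[R]_p)
  (mbhat : forall n, random_vector (bhat n))
  (bhatE : forall n w,
    argmin_spec (full_loss n (W ^~ w) (y ^~ w) Sigma) (bhat n w))
  (* subsampling probabilities: [pi n i] for the i-th point among n *)
  (pi : nat -> nat -> T -> R)
  (pi_ge0 : forall n i w, (i < n)%N -> 0 <= pi n i w)
  (pi_sum : forall n w, (0 < n)%N -> \sum_(i < n) pi n i w = 1)
  (* drawn indices: given the data, r independent draws from pi n *)
  (K : forall n r : nat, 'I_r -> T -> nat)
  (mK : forall n r (j : 'I_r) (k : nat), measurable [set w | K n r j w = k])
  (K_lt : forall n r (j : 'I_r) w, (0 < n)%N -> (K n r j w < n)%N)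
  (K_law : forall n r (k : 'I_r -> 'I_n), (0 < n)%N ->
    is_cond_prob P (sigma_data W y n)
      [set w | forall j : 'I_r, K n r j w = k j]
      (fun w => \prod_(j < r) pi n (k j) w))
  (* subsample estimator *)
  (btil : nat -> nat -> T -> 'cV[R]_p)
  (mbtil : forall n r, random_vector (btil n r))
  (btilE : forall n r w,
    argmin_spec
      (sub_loss n (W ^~ w) (y ^~ w) (pi n ^~ w) ((K n r) ^~ w) Sigma)
      (btil n r w))
  (* (A1) *)
  (H : 'M[R]_p) (H_pd : posdefmx H)
  (A1 : mx_cvg_in_prob P (fun n w => HW n (W ^~ w) Sigma) H)
  (* (A2) *)
  (A2W : OP1 P (fun n w =>
    (n%:R^-1 * \sum_(i < n) enorm (W i w) ^+ 4)%:E))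
  (A2y : OP1 P (fun n w =>
    (n%:R^-1 * \sum_(i < n) (y i w - dotv (W i w) (bhat n w)) ^+ 4)%:E))
  (* (A3) *)
  (A3 : OP1 P (fun n w =>
    (\big[maxe/0]_(i < n) ((n%:R * pi n i w)%:E)^-1)%E))
  (* any versions of P(|| btil - bhat || >= r^{-1/2} c | F_n) *)
  (cp : nat -> nat -> R -> T -> R)
  (cpE : forall n r (c : R),
    is_cond_prob P (sigma_data W y n)
      [set w | (Num.sqrt r%:R)^-1 * c <= enorm (btil n r w - bhat n w)]
      (cp n r c)) :
  with_prob_approaching_one P (fun n w =>
    forall e : R, 0 < e -> exists (Delta : R) (r0 : nat),
      forall r, (r0 < r)%N -> cp n r Delta w < e)
  /\
  (* the constants can be taken independent of n (and of the sample point) on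
     events of probability arbitrarily close to one *)
  (forall delta : R, 0 < delta ->
    exists (Delta : R -> R) (r0 : R -> nat) (N : nat),
      forall n, (N <= n)%N -> exists A : set T,
        [/\ measurable A,
            ((1 - delta)%:E <= P A)%E
          & forall w, A w -> forall e : R, 0 < e ->
              forall r, (r0 e < r)%N -> cp n r (Delta e) w < e]).
Proof.
have mX' i : mx_measurable (X i) by move=> j k; rewrite ord1; apply: mX.
have mU' i : mx_measurable (U i) by move=> j k; rewrite ord1; apply: mU.
have mW i : random_vector (W i).
  move=> j; rewrite (_ : W i = fun w => X i w + U i w); last exact/funext/WE.
  exact: mx_measurableD.
have my i : measurable_fun [set: T] (y i).
  rewrite (_ : y i = fun w => dotv (X i w) beta + eps i w).
    apply: measurable_funD => //.
    exact: (measurable_dotv (v := fun=> beta)).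
  exact/funext/yE.
have S_sym : Sigma^T = Sigma.
  apply/matrixP => i j; rewrite mxE.
  by apply: EFin_inj; rewrite -!(U_cov 0%N) covarianceC.
have F_sub n := sigma_data_measurable (n := n) mW my.
(* With a single draw, the law of the index is [pi n] itself, hence [pi n] is
   decided by the data. *)
have pi_data n i : (i < n)%N ->
    @measurable_fun _ _ (g_sigma_algebraType (data_events W y n)) _
      [set: T] (pi n i).
  move=> ni _ B mB; rewrite setTI.
  have [+ _ _] := K_law n 1%N (fun=> Ordinal ni) (leq_ltn_trans (leq0n i) ni).
  move=> /(_ B mB); congr (sigma_data W y n _).
  by apply/seteqP; split => w /=; rewrite big_ord1.
have mpi n i : (i < n)%N -> measurable_fun [set: T] (pi n i).
  move=> ni _ B mB; rewrite setTI; apply: (F_sub n).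
  by have := pi_data n i ni measurableT B mB; rewrite setTI.
have [lam lam0 cH] := posdef_coercive H_pd.
pose good_event n (M : nat) :=
  [set w | good n (W ^~ w) (y ^~ w) (pi n ^~ w) H Sigma lam M%:R].
have mgood n M : measurable (good_event n M) by apply: measurable_good_event.
(* Constants for the bound [M] on the dataset and the accuracy [1 / (m + 1)];
   they do not depend on [n]. *)
have /choice[c cP] : forall Mm : nat * nat, exists c : R * nat, 0 < c.1 /\
    forall r, (c.2 < r)%N ->
      rate_bound (p := p) lam Mm.1%:R c.1 r < Mm.2.+1%:R^-1.
  move=> [M m].
  have [|Delta [r0 [Delta0 small]]] := rate_bound_small (p := p) M%:R lam0
    (e := m.+1%:R^-1); first by rewrite invr_gt0.
  by exists (Delta, r0).
pose large n M m r :=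
  [set w | (c (M, m)).2 < r]%N `&` (good_event n M `&`
    [set w | m.+1%:R^-1 <= cp n r (c (M, m)).1 w]).
have large0 n M m r : (0 < n)%N -> P.-negligible (large n M m r).
  move=> n0; have [r0|r0] := ltnP (c (M, m)).2 r; last first.
    apply: negligibleS (negligible_set0 P) => w [/=].
    by rewrite ltnNge r0.
  have [Delta0 /(_ r r0) small] := cP (M, m).
  have mcp := is_cond_prob_measurable (F_sub n) (cpE n r (c (M, m)).1).
  apply: negligibleS (@subIsetr _ _ _) _; apply/negligibleP.
    by apply: measurableI => //; apply: measurable_set_le.
  apply: (cond_prob_rate mW my S_sym lam0 cH n0 (pi_ge0 n)
    (fun w => pi_sum n w n0) (K := K n r) (bhat := bhat n) (btil := btil n r)
    (Delta := (c (M, m)).1)) => //.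
  - by apply: leq_ltn_trans r0.
  - by move=> i ni; apply: pi_data.
  - by move=> j w; apply: K_lt.
  - by move=> k; apply: K_law.
pose null n M := \bigcup_m \bigcup_r large n M m r.
have null0 n M : (0 < n)%N -> P.-negligible (null n M).
  by move=> n0; do 2!apply: negligible_bigcup => ?; apply: large0.
have mnull n M : measurable (null n M).
  apply: bigcup_measurable => m _; apply: bigcup_measurable => r _.
  have mcp := is_cond_prob_measurable (F_sub n) (cpE n r (c (M, m)).1).
  apply: measurableI; last first.
    by apply: measurableI => //; apply: measurable_set_le.
  case: ((c (M, m)).2 < r)%N.
    by rewrite (_ : mkset _ = setT) ?predeqE.
  by rewrite (_ : mkset _ = set0) ?predeqE.
pose A n M := good_event n M `\` null n M.
have mA n M : measurable (A n M) by apply: measurableD.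
have A_likely (delta : R) : 0 < delta -> exists M N : nat, (0 < N)%N /\
    forall n, (N <= n)%N -> ((1 - delta)%:E <= P (A n M))%E.
  move=> delta0.
  have [M [N NP]] := good_event_likely mW my S_sym lam0 cH mpi pi_ge0 mbhat
    bhatE A1 A2W A2y A3 delta0.
  exists M, N.+1; split => // n Nn.
  have n0 : (0 < n)%N by apply: leq_trans Nn.
  have -> : P (A n M) = P (good_event n M).
    rewrite measureD//; last by rewrite ltey_eq fin_num_measure.
    rewrite [X in (_ - X)%E](_ : _ = 0%E) ?sube0//.
    apply: measure_negligible; first exact: measurableI.
    exact: negligibleS (@subIsetr _ _ _) (null0 n M n0).
  have := NP n (ltnW Nn); rewrite probability_setC; last exact: mgood.
  have /fineK <- := fin_num_measure P _ (mgood n M).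
  by rewrite -EFinB lte_fin lee_fin; lra.
have /choice[m mP] : forall e : R, exists m, 0 < e -> m.+1%:R^-1 <= e.
  move=> e; have [e0|e0] := ltP 0 e; last first.
    by exists 0%N.
  exists (Num.bound e^-1) => _.
  have e'0 : 0 < e^-1 by rewrite invr_gt0.
  rewrite -[leRHS]invrK lef_pV2 ?posrE//.
  by apply: le_trans (ltW (archi_boundP (ltW e'0))) _; rewrite ler_nat.
have A_rate : forall n M w e, A n M w -> 0 < e ->
    forall r, ((c (M, m e)).2 < r)%N -> cp n r (c (M, m e)).1 w < e.
  move=> n M w e [gw nw] e0 r rc; apply: lt_le_trans (mP e e0).
  rewrite ltNge; apply/negP => le_cp; apply: nw.
  by exists (m e) => //; exists r.
split.
  exists (fun n => \bigcup_M A n M); split.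
  - by move=> n; apply: bigcup_measurable.
  - move=> n w [M _ Aw] e e0.
    exists (c (M, m e)).1, (c (M, m e)).2; exact: A_rate.
  - have mUA n : measurable (\bigcup_M A n M) by apply: bigcup_measurable.
    apply/fine_cvgP; split.
      by apply: nearW => n; apply: fin_num_measure.
    apply/cvgrPdist_le => e e0; have [M [N [_ NP]]] := A_likely e e0.
    exists N => // n /= Nn.
    have AU : (P (A n M) <= P (\bigcup_M A n M))%E.
      by apply: le_measure; rewrite ?inE//; apply: bigcup_sup.
    have := le_trans (NP n Nn) AU; have := probability_le1 P (mUA n).
    have /fineK <- := fin_num_measure P _ (mUA n).
    rewrite !lee_fin => P1 Pe /=; rewrite ger0_norm ?subr_ge0//; lra.
move=> delta delta0; have [M [N [_ NP]]] := A_likely delta delta0.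
exists (fun e => (c (M, m e)).1), (fun e => (c (M, m e)).2), N => n Nn.
exists (A n M); split => //; first exact: NP.
by move=> w Aw e e0; apply: A_rate.
Qed.
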